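(* Every atomic sheaf on the category $\mathbb{S}\mathsf{ur}$ has supports.
   Context: $\mathbb{S}\mathsf{ur}$ is (a small version of) the category of nonempty finite sets and surjective functions; all its morphisms are epimorphisms and it is coconfluent. For a presheaf $P\colon\mathbb{S}\mathsf{ur}^{op}\to\mathbf{Set}$ write $x\cdot f := P(f)(x)$. $P$ is an atomic sheaf if for every $c\colon Y\to X$, every $y\in P(Y)$ satisfying $y\cdot d = y\cdot e$ for all $d,e\colon Z\to Y$ with $c\circ d = c\circ e$ equals $x\cdot c$ for a unique $x\in P(X)$. A representable factorisation of $x\in P(X)$ is a triple $(Y,q,y)$ with $q\colon X\to Y$, $y\in P(Y)$, $x = y\cdot q$; a morphism $(Y,q,y)\to(Y',q',y')$ is a map $r\colon Y\to Y'$ with $r\circ q = q'$ and $y'\cdot r = y$ (necessarily unique). A support for $x$ is a terminal object of this preorder of representable factorisations. $P$ has supports if every element of every $P(X)$ has a support. *)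

(* Defs.v *)
From mathcomp Require Import all_boot.

Set Implicit Arguments.
Unset Strict Implicit.
Unset Printing Implicit Defensive.

Declare Scope cat_scope.
Delimit Scope cat_scope with cat.
Local Open Scope cat_scope.

Record category := Category {
  obj :> Type;
  hom : obj -> obj -> Type;
  idm : forall X, hom X X;
  comp : forall X Y Z, hom Y Z -> hom X Y -> hom X Z;
  comp1m : forall X Y (f : hom X Y), comp (idm Y) f = f;
  compm1 : forall X Y (f : hom X Y), comp f (idm X) = f;
  compA : forall X Y Z W (h : hom Z W) (g : hom Y Z) (f : hom X Y),
    comp h (comp g f) = comp (comp h g) f }.

Arguments hom {c} X Y.
Arguments idm {c} X.
Arguments comp {c X Y Z} g f.

Notation "g ∘ f" := (comp g f) (at level 40, left associativity) : cat_scope.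

(* Contravariant functors to sets; act f x is P(f)(x), written x ⋅ f. *)
Record presheaf (C : category) := Presheaf {
  psh :> C -> Type;
  act : forall X Y : C, hom X Y -> psh Y -> psh X;
  act1 : forall (X : C) (x : psh X), act (idm X) x = x;
  actM : forall (X Y Z : C) (g : hom Y Z) (f : hom X Y) (z : psh Z),
    act (g ∘ f) z = act f (act g z) }.

Arguments act {C p X Y} f x.

Notation "x ⋅ f" := (act f x) (at level 40, left associativity) : cat_scope.

Section AtomicSheaves.
Variables (C : category) (P : presheaf C).

Definition atomic_sheaf : Prop :=
  forall (X Y : C) (c : hom Y X) (y : P Y),
    (forall (Z : C) (d e : hom Z Y), c ∘ d = c ∘ e -> y ⋅ d = y ⋅ e) ->
    exists! x : P X, y = x ⋅ c.

Record rep_factorisation (X : C) (x : P X) := RepFactorisation {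
  rf_obj : C;
  rf_map : hom X rf_obj;
  rf_elt : P rf_obj;
  rf_eq : x = rf_elt ⋅ rf_map }.

Definition is_rf_morphism (X : C) (x : P X) (F G : rep_factorisation x)
    (r : hom (rf_obj F) (rf_obj G)) : Prop :=
  r ∘ rf_map F = rf_map G /\ rf_elt G ⋅ r = rf_elt F.

Definition is_support (X : C) (x : P X) (S : rep_factorisation x) : Prop :=
  forall F : rep_factorisation x,
    exists! r : hom (rf_obj F) (rf_obj S), is_rf_morphism r.

Definition has_supports : Prop :=
  forall (X : C) (x : P X), exists S : rep_factorisation x, is_support S.

End AtomicSheaves.

Record nefin := NeFin { nefin_sort :> finType; nefin_gt0 : 0 < #|nefin_sort| }.

Definition surjb (X Y : finType) (f : {ffun X -> Y}) : bool :=
  [forall y, exists x, f x == y].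

(* A surjection is a finite function with a boolean proof of surjectivity, so
   that equality of morphisms is pointwise equality. *)
Definition sur_hom (X Y : nefin) : Type := {f : {ffun X -> Y} | surjb f}.

Lemma surj_id (X : finType) : surjb [ffun x : X => x].
Proof. by apply/forallP=> x; apply/existsP; exists x; rewrite ffunE. Qed.

Lemma surj_comp (X Y Z : finType) (g : {ffun Y -> Z}) (f : {ffun X -> Y}) :
  surjb g -> surjb f -> surjb [ffun x => g (f x)].
Proof.
move=> /forallP sg /forallP sf; apply/forallP=> z.
have /existsP[y /eqP <-] := sg z; have /existsP[x /eqP <-] := sf y.
by apply/existsP; exists x; rewrite ffunE.
Qed.

Definition sur_id (X : nefin) : sur_hom X X :=
  exist (fun f : {ffun X -> X} => surjb f) _ (surj_id X).

Definition sur_comp (X Y Z : nefin) (g : sur_hom Y Z) (f : sur_hom X Y) :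
    sur_hom X Z :=
  exist (fun h : {ffun X -> Z} => surjb h) _ (surj_comp (valP g) (valP f)).

Lemma sur_comp1m (X Y : nefin) (f : sur_hom X Y) : sur_comp (sur_id Y) f = f.
Proof. by apply/val_inj/ffunP=> x; rewrite /= !ffunE. Qed.

Lemma sur_compm1 (X Y : nefin) (f : sur_hom X Y) : sur_comp f (sur_id X) = f.
Proof. by apply/val_inj/ffunP=> x; rewrite /= !ffunE. Qed.

Lemma sur_compA (X Y Z W : nefin)
    (h : sur_hom Z W) (g : sur_hom Y Z) (f : sur_hom X Y) :
  sur_comp h (sur_comp g f) = sur_comp (sur_comp h g) f.
Proof. by apply/val_inj/ffunP=> x; rewrite /= !ffunE. Qed.

(* Small, as its objects are the nonempty finite types of one fixed universe. *)
Definition Sur : category := Category sur_comp1m sur_compm1 sur_compA.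

(* Main.v *)
(** Call two points [a], [b] of [X] equivalent for [x : P X] when the extensions
    [[id, a]] and [[id, b]] of the identity of [X] to [X + 1] act equally on
    [x]. The support of [x] is the quotient [q] of [X] by this relation. Every
    representable factorisation of [x] identifies equivalent points only, so it
    maps to [q]; the point is that [x] itself factors through [q]. By the sheaf
    property we need [x ⋅ d = x ⋅ e] for surjections [d, e : Z -> X] that are
    pointwise equivalent. Changing [d] into [e] one point at a time may break
    surjectivity; so we pull back along the fold map [Z + Z -> Z], and modify
    only one of the two copies of [Z] at a time. *)
Require Import Defs.
From mathcomp Require Import all_boot.
From mathcomp Require Import boolp.

Set Implicit Arguments.
Unset Strict Implicit.
Unset Printing Implicit Defensive.
Local Open Scope cat_scope.

(** An element of the form [x ⋅ c] always meets the sheaf condition for [c], and all its preimages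
    coincide by the uniqueness of descent. *)
Lemma atomic_sheaf_act_inj (C : category) (P : presheaf C) (X Y : C)
    (c : hom Y X) :
  atomic_sheaf P -> injective (fun x : P X => x ⋅ c).
Proof.
move=> shP x x' /= eq_xx'.
have [|z [_ uniq_z]] := shP X Y c (x ⋅ c); first by move=> Z d e cde; rewrite -!actM cde.
by rewrite -(uniq_z x) // (uniq_z x').
Qed.

Section Surjections.
Implicit Types X Y Z : nefin.

Lemma surjbP (X Y : finType) (f : {ffun X -> Y}) :
  reflect (forall y, exists x, f x = y) (surjb f).
Proof.
apply: (iffP forallP) => sf y; first by have /existsP[x /eqP] := sf y; exists x.
by have [x fx] := sf y; apply/existsP; exists x; apply/eqP.
Qed.

Lemma surjb_ffun (X Y : finType) (f : X -> Y) :
  (forall y, exists x, f x = y) -> surjb (finfun f).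
Proof. by move=> sf; apply/surjbP=> y; have [x <-] := sf y; exists x; rewrite ffunE. Qed.

Definition mk_sur X Y (f : X -> Y) (sf : forall y, exists x, f x = y) :
    hom (X : Sur) (Y : Sur) :=
  exist (fun g : {ffun X -> Y} => surjb g) _ (surjb_ffun sf).

Definition sur_fun X Y (f : hom (X : Sur) (Y : Sur)) : X -> Y := val f.

Lemma mk_surE X Y (f : X -> Y) (sf : forall y, exists x, f x = y) :
  sur_fun (mk_sur sf) =1 f.
Proof. by move=> x; rewrite /sur_fun /= ffunE. Qed.

Lemma sur_compE X Y Z (g : hom (Y : Sur) (Z : Sur)) (f : hom (X : Sur) (Y : Sur)) :
  sur_fun (g ∘ f) =1 sur_fun g \o sur_fun f.
Proof. by move=> x; rewrite /sur_fun /= ffunE. Qed.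

Lemma sur_funP X Y (f : hom (X : Sur) (Y : Sur)) y : exists x, sur_fun f x = y.
Proof. exact: (surjbP _ (valP f)). Qed.

Lemma sur_ext X Y (f g : hom (X : Sur) (Y : Sur)) : sur_fun f =1 sur_fun g -> f = g.
Proof. by move=> fg; apply/val_inj/ffunP. Qed.

Lemma sur_epi X Y Z (f : hom (X : Sur) (Y : Sur)) (g h : hom (Y : Sur) (Z : Sur)) :
  g ∘ f = h ∘ f -> g = h.
Proof.
move=> gfhf; apply: sur_ext => y; have [x <-] := sur_funP f y.
by have := congr1 (fun k => sur_fun k x) gfhf; rewrite !sur_compE.
Qed.

(** The map [r] is [q] after a chosen section [s] of [p]; [s] need not be surjective, but the
    composite is, because [q] is. *)
Lemma sur_factor X Y Z (q : hom (X : Sur) (Y : Sur)) (p : hom (X : Sur) (Z : Sur)) :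
  (forall a b, sur_fun p a = sur_fun p b -> sur_fun q a = sur_fun q b) ->
  exists r : hom (Z : Sur) (Y : Sur), r ∘ p = q.
Proof.
move=> pq; pose s z := xchoose (existsP (forallP (valP p) z)).
have sK z : sur_fun p (s z) = z by apply/eqP/(xchooseP (existsP (forallP (valP p) z))).
have rE a : sur_fun q (s (sur_fun p a)) = sur_fun q a by apply: pq; rewrite sK.
have sr y : exists z, sur_fun q (s z) = y.
  by have [a <-] := sur_funP q y; exists (sur_fun p a).
by exists (mk_sur sr); apply: sur_ext => a; rewrite sur_compE /= mk_surE.
Qed.

(** [T] is an arbitrary type, so the image of [k] is not at hand as a finite type. The fibres of
    [k], as subsets of [X] cut out classically, serve as points instead. *)
Lemma sur_quotient X (T : Type) (k : X -> T) :
  exists Y : nefin, exists q : hom (X : Sur) (Y : Sur),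
    forall a b, sur_fun q a = sur_fun q b <-> k a = k b.
Proof.
pose cls a : {set X} := [set b | `[< k a = k b >]].
have cls_codom a : cls a \in codom cls by exact: codom_f.
pose q a : {A : {set X} | A \in codom cls} := exist _ (cls a) (cls_codom a).
have /card_gt0P[a0 _] := nefin_gt0 X.
have Y_gt0 : 0 < #|{: {A : {set X} | A \in codom cls}}|.
  by apply/card_gt0P; exists (q a0).
have sq (y : NeFin Y_gt0) : exists a, q a = y.
  by case: y => A cA; have /codomP[a Aa] := cA; exists a; apply: val_inj.
exists (NeFin Y_gt0), (mk_sur sq) => a b; rewrite !mk_surE; split=> [[qab]|kab].
  have : b \in cls a by rewrite qab inE; apply/asboolP.
  by rewrite inE => /asboolP.
by apply: val_inj; apply/setP=> c; rewrite !inE kab.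
Qed.

Lemma card_option_gt0 X : 0 < #|{: option X}|.
Proof. by rewrite card_option. Qed.

Definition nefin_option X := NeFin (card_option_gt0 X).

Lemma card_sum_gt0 X Y : 0 < #|{: X + Y}|.
Proof. by rewrite card_sum addn_gt0 nefin_gt0. Qed.

Definition nefin_sum X Y := NeFin (card_sum_gt0 X Y).

Lemma odflt_surj X (a : X) : forall b, exists o : nefin_option X, odflt a o = b.
Proof. by move=> b; exists (Some b). Qed.

Definition sur_odflt X (a : X) : hom (nefin_option X : Sur) (X : Sur) :=
  mk_sur (odflt_surj a).

Lemma copair_surj X Z (d : hom (Z : Sur) (X : Sur)) (g : Z -> X) :
  forall b, exists w : nefin_sum Z Z,
    (match w with inl z => sur_fun d z | inr z => g z end) = b.
Proof. by move=> b; have [z <-] := sur_funP d b; exists (inl z). Qed.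

Definition sur_copair X Z (d : hom (Z : Sur) (X : Sur)) (g : Z -> X) :
    hom (nefin_sum Z Z : Sur) (X : Sur) :=
  mk_sur (copair_surj d g).

End Surjections.

Section Indistinguishable.
Variables (P : presheaf Sur) (X : nefin) (x : P X).

Definition adjoin_point (a : X) : P (nefin_option X) := x ⋅ sur_odflt a.

(** Both maps factor through the same [k : W -> X + 1], which sends [w0] to the added point; [k] is
    onto because [d] is already onto away from [w0]. *)
Lemma act_eq_off_point (W : nefin) (w0 : W) (d e : hom (W : Sur) (X : Sur)) :
  (forall w, w != w0 -> sur_fun d w = sur_fun e w) ->
  (forall b, exists2 w, w != w0 & sur_fun d w = b) ->
  adjoin_point (sur_fun d w0) = adjoin_point (sur_fun e w0) ->
  x ⋅ d = x ⋅ e.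
Proof.
move=> de sd eq_pt.
pose k w := if w == w0 then None else Some (sur_fun d w).
have sk (o : nefin_option X) : exists w, k w = o.
  case: o => [b|]; last by exists w0; rewrite /k eqxx.
  by have [w ww0 <-] := sd b; exists w; rewrite /k (negPf ww0).
have -> : d = sur_odflt (sur_fun d w0) ∘ mk_sur sk.
  apply: sur_ext => w; rewrite sur_compE /= !mk_surE /k.
  by case: eqVneq => [->|].
have -> : e = sur_odflt (sur_fun e w0) ∘ mk_sur sk.
  apply: sur_ext => w; rewrite sur_compE /= !mk_surE /k.
  by case: eqVneq => [->|/de].
by rewrite !actM -/(adjoin_point _) eq_pt.
Qed.

Lemma act_copair (Z : nefin) (d : hom (Z : Sur) (X : Sur)) (g : Z -> X) :
  (forall z, adjoin_point (sur_fun d z) = adjoin_point (g z)) ->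
  x ⋅ sur_copair d (sur_fun d) = x ⋅ sur_copair d g.
Proof.
(* [s] lists the points of the second copy already changed from [d] to [g]; the untouched first copy
   keeps every intermediate map surjective. *)
move=> dg; pose h (s : seq Z) z := if z \in s then g z else sur_fun d z.
have hE s : x ⋅ sur_copair d (sur_fun d) = x ⋅ sur_copair d (h s).
  elim: s => [|z s ->].
    by congr (x ⋅ _); apply: sur_ext => w; rewrite !mk_surE.
  apply: (@act_eq_off_point (nefin_sum Z Z) (inr z)).
  - move=> [z'|z'] neq; rewrite !mk_surE // /h inE.
    by case: eqVneq => // z'z; rewrite z'z eqxx in neq.
  - by move=> b; have [z' <-] := sur_funP d b; exists (inl z'); rewrite // mk_surE.
  - by rewrite !mk_surE /h mem_head; case: ifP.
rewrite (hE (enum Z)); congr (x ⋅ _); apply: sur_ext => w.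
by rewrite !mk_surE; case: w => // z; rewrite /h mem_enum.
Qed.

Lemma act_eq_pointwise (Z : nefin) (d e : hom (Z : Sur) (X : Sur)) :
  atomic_sheaf P ->
  (forall z, adjoin_point (sur_fun d z) = adjoin_point (sur_fun e z)) ->
  x ⋅ d = x ⋅ e.
Proof.
move=> shP de.
have sfold z : exists w : nefin_sum Z Z, (match w with inl z' | inr z' => z' end) = z.
  by exists (inl z).
have sswap (w : nefin_sum Z Z) : exists w' : nefin_sum Z Z,
    (match w' with inl z => inr z | inr z => inl z end) = w.
  by case: w => z; [exists (inr z) | exists (inl z)].
have foldE f : f ∘ mk_sur sfold = sur_copair f (sur_fun f).
  by apply: sur_ext => w; rewrite sur_compE /= !mk_surE; case: w.
have swapE f g : sur_copair f (sur_fun g) ∘ mk_sur sswap = sur_copair g (sur_fun f).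
  by apply: sur_ext => w; rewrite sur_compE /= !mk_surE; case: w.
apply: (@atomic_sheaf_act_inj _ _ _ _ (mk_sur sfold) shP) => /=.
(* On [x], [[d, d]] acts as [[d, e]]; swapping the copies, it also acts as [[e, d]], and this acts
   as [[e, e]] by the same lemma with [d] and [e] exchanged. *)
rewrite -!actM !foldE -(swapE _ d d) actM (act_copair de) -actM swapE.
by apply/esym/act_copair.
Qed.

End Indistinguishable.

Theorem theorem7p7 (P : presheaf Sur) : atomic_sheaf P -> has_supports P.
Proof.
move=> shP X x.
have [Y [q qE]] := sur_quotient (adjoin_point x).
have [|y [xy _]] := shP Y X q x.
  move=> Z d e qdqe; apply: act_eq_pointwise => // z; apply/qE.
  by have := congr1 (fun k => sur_fun k z) qdqe; rewrite !sur_compE.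
exists (RepFactorisation xy) => -[Y' p y' xy'] /=.
have [a b pab|r rp] := @sur_factor _ _ _ q p.
  (* Since [p] identifies [a] and [b], its composites with [[id, a]] and [[id, b]] coincide, and [x]
     is [y' ⋅ p]. *)
  apply/qE; rewrite /adjoin_point xy' -!actM; congr (y' ⋅ _).
  apply: sur_ext => o; rewrite !sur_compE /= !mk_surE.
  by case: o.
exists r; split=> [|r' [r'p _]]; last exact: sur_epi (etrans rp (esym r'p)).
(* The equation [y ⋅ r = y'] may be tested after acting by [p], where both sides become [x]. *)
split=> //=; apply: (@atomic_sheaf_act_inj _ _ _ _ p shP) => /=.
by rewrite -actM rp -xy -xy'.
Qed.
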